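(* Let $A\in M_n(\mathbb{C})$. The upper bild of $A$ is given by $$B^+(A)=\operatorname{conv}\{W_{\mathbb{C}}^+(A),\,W_{\mathbb{C}}^+(A^* ),\,\underline{v},\,\overline{v}\},$$ where $\underline{v}=\min\big(B(A)\cap\mathbb{R}\big)$ and $\overline{v}=\max\big(B(A)\cap\mathbb{R}\big)$.
   Context: $\mathbb{H}$ denotes the Hamilton quaternions with real basis $1,i,j,k$, and $\mathbb{C}=\mathrm{span}_{\mathbb{R}}\{1,i\}\subset\mathbb{H}$. $M_n(\mathbb{F})$ is the set of $n\times n$ matrices with entries in $\mathbb{F}$. For $\mathbb{F}=\mathbb{C}$ or $\mathbb{H}$, $A\in M_n(\mathbb{F})$, and $\boldsymbol{x}\in\mathbb{F}^n$ a column vector, $\boldsymbol{x}^*$ and $A^*$ denote conjugate transposes, and the numerical range is $W_{\mathbb{F}}(A)=\{\boldsymbol{x}^*A\boldsymbol{x}:\boldsymbol{x}\in\mathbb{F}^n,\ \boldsymbol{x}^*\boldsymbol{x}=1\}$. A complex matrix is regarded as a quaternionic matrix. $\mathbb{C}^+$ denotes the closed upper half plane $\{z\in\mathbb{C}:\mathrm{Im}\,z\ge 0\}$. The bild of $A$ is $B(A)=W_{\mathbb{H}}(A)\cap\mathbb{C}$, the upper bild is $B^+(A)=W_{\mathbb{H}}(A)\cap\mathbb{C}^+$, and $W_{\mathbb{C}}^+(A)=W_{\mathbb{C}}(A)\cap\mathbb{C}^+$. The notation $\operatorname{conv}\{X,Y,\dots\}$ means the convex hull in $\mathbb{C}$ of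 the union of the listed sets and points.
   Formalization: For n = 1 and A = (a) with a non-real, B(A) ∩ ℝ is empty, so its minimum and maximum do not exist; the formal statement then omits these two points from the list, and asserts that they exist for every n ≥ 2. *)

(* Defs.v *)
From HB Require Import structures.
From mathcomp Require Import all_boot all_order all_algebra ring.
From mathcomp Require Import all_classical all_reals all_analysis.
From mathcomp Require Import complex.

Set Implicit Arguments.
Unset Strict Implicit.
Unset Printing Implicit Defensive.

Import Order.TTheory GRing.Theory Num.Theory.

Local Open Scope classical_set_scope.
Local Open Scope ring_scope.
Local Open Scope complex_scope.

(* Quat a b c d stands for a + b i + c j + d k. *)
Record quat (R : Type) := Quat { qre : R; qi : R; qj : R; qk : R }.

Section QuatRing.

Definition tuple_of_quat (R : Type) (x : quat R) : R * R * R * R :=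
  (qre x, qi x, qj x, qk x).
Definition quat_of_tuple (R : Type) (t : R * R * R * R) : quat R :=
  let: (a, b, c, d) := t in Quat a b c d.
Lemma tuple_of_quatK (R : Type) :
  cancel (@tuple_of_quat R) (@quat_of_tuple R).
Proof. by case. Qed.

HB.instance Definition _ (R : eqType) :=
  Equality.copy (quat R) (can_type (@tuple_of_quatK R)).
HB.instance Definition _ (R : choiceType) :=
  Choice.copy (quat R) (can_type (@tuple_of_quatK R)).

Variable R : comNzRingType.
Implicit Types x y z : quat R.

Definition quat_zero : quat R := Quat 0 0 0 0.
Definition quat_one : quat R := Quat 1 0 0 0.
Definition quat_opp x := Quat (- qre x) (- qi x) (- qj x) (- qk x).
Definition quat_add x y :=
  Quat (qre x + qre y) (qi x + qi y) (qj x + qj y) (qk x + qk y).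
Definition quat_mul x y :=
  Quat (qre x * qre y - qi x * qi y - qj x * qj y - qk x * qk y)
       (qre x * qi y + qi x * qre y + qj x * qk y - qk x * qj y)
       (qre x * qj y - qi x * qk y + qj x * qre y + qk x * qi y)
       (qre x * qk y + qi x * qj y - qj x * qi y + qk x * qre y).

Lemma quat_addA : associative quat_add.
Proof. by move=> x y z; rewrite /quat_add /= !addrA. Qed.
Lemma quat_addC : commutative quat_add.
Proof.
by move=> x y; rewrite /quat_add (addrC (qre x)) (addrC (qi x)) (addrC (qj x))
  (addrC (qk x)).
Qed.
Lemma quat_add0 : left_id quat_zero quat_add.
Proof. by case=> a b c d; rewrite /quat_add /= !add0r. Qed.
Lemma quat_addN : left_inverse quat_zero quat_opp quat_add.
Proof. by case=> a b c d; rewrite /quat_add /quat_opp /= !addNr. Qed.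

HB.instance Definition _ :=
  GRing.isZmodule.Build (quat R) quat_addA quat_addC quat_add0 quat_addN.

Lemma quat_mulA : associative quat_mul.
Proof. by move=> x y z; congr Quat => /=; ring. Qed.
Lemma quat_mul1l : left_id quat_one quat_mul.
Proof. by case=> a b c d; congr Quat => /=; ring. Qed.
Lemma quat_mul1r : right_id quat_one quat_mul.
Proof. by case=> a b c d; congr Quat => /=; ring. Qed.
Lemma quat_mulDl : left_distributive quat_mul quat_add.
Proof. by move=> x y z; congr Quat => /=; ring. Qed.
Lemma quat_mulDr : right_distributive quat_mul quat_add.
Proof. by move=> x y z; congr Quat => /=; ring. Qed.
Lemma quat_one_neq0 : quat_one != 0 :> quat R.
Proof. by apply/eqP => -[] /eqP; rewrite oner_eq0. Qed.

HB.instance Definition _ := GRing.Zmodule_isNzRing.Build (quat R)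
  quat_mulA quat_mul1l quat_mul1r quat_mulDl quat_mulDr quat_one_neq0.

Definition quat_conj x := Quat (qre x) (- qi x) (- qj x) (- qk x).

Definition quat_of_complex (z : R[i]) : quat R :=
  Quat (complex.Re z) (complex.Im z) 0 0.

End QuatRing.

Definition adjmx (F : Type) (conj : F -> F) (m n : nat) (A : 'M[F]_(m, n)) :
  'M[F]_(n, m) := (map_mx conj A)^T.

Definition numrange (F : pzRingType) (conj : F -> F) (n : nat) (A : 'M[F]_n) :
    set F :=
  [set w | exists x : 'cV[F]_n,
     adjmx conj x *m x = 1%:M /\ w = (adjmx conj x *m A *m x) ord0 ord0].

Section Bild.
Variable R : realType.

Definition upper_half : set R[i] := [set z | 0 <= complex.Im z].

Definition numrangeC (n : nat) (A : 'M[R[i]]_n) : set R[i] :=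
  numrange (@conjc R) A.

Definition numrangeH (n : nat) (A : 'M[quat R]_n) : set (quat R) :=
  numrange (@quat_conj R) A.

Definition upper_numrangeC (n : nat) (A : 'M[R[i]]_n) : set R[i] :=
  numrangeC A `&` upper_half.

Definition bild (n : nat) (A : 'M[quat R]_n) : set R[i] :=
  @quat_of_complex R @^-1` numrangeH A.

Definition upper_bild (n : nat) (A : 'M[quat R]_n) : set R[i] :=
  bild A `&` upper_half.

Definition real_bild (n : nat) (A : 'M[quat R]_n) : set R :=
  [set r | bild A r%:C].

Definition quatmx (n : nat) (A : 'M[R[i]]_n) : 'M[quat R]_n :=
  map_mx (@quat_of_complex R) A.

(* Empty or a singleton: S may fail to have a least (greatest) element. *)
Definition min_set (S : set R) : set R := S `&` lbound S.
Definition max_set (S : set R) : set R := S `&` ubound S.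

(* Rcomplex R is R[i] as a vector space over R. *)
Definition conv_hull (X : set R[i]) : set R[i] :=
  smallest (@convex_set R (Rcomplex R)) X.

End Bild.

(* Main.v *)
Require Import Defs.
From HB Require Import structures.
From mathcomp Require Import all_boot all_order all_algebra ring lra.
From mathcomp Require Import all_classical all_reals all_analysis.
From mathcomp Require Import complex.

(* By conjugating with unit quaternions, h + k i (k >= 0) lies in the upper bild
   of A iff some x <> 0 has Re (x^*Ax) = h |x|^2 and |Vec (x^*Ax)| = k |x|^2.
   The upper bild of any quaternionic matrix is convex: let x, e be unit vectors
   attaining two of its points, and let (h, k) be a convex combination of them.
   On the path y = x q (1 - s) + e s some s gives Re (y^*Ay) = h |y|^2. If q
   makes the cross term of y^*Ay real, the triangle inequality gives
   |Vec (y^*Ay)| <= k |y|^2 after possibly changing the sign of q; among q = 1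
   and q = -1, one gives |Vec (y^*Ay)| >= k |y|^2. Two such vectors at the same
   height h are joined by a path with Re (y^*Ay) = h |y|^2, obtained by taking q
   orthogonal to one quaternion, and the intermediate value theorem gives k.

   For complex A write x = u + w j with u, w complex. Then x^*Ax is the sum of
   u^*Au, of the conjugate of w^*Aw, and of a term in span(j, k), which vanishes
   if x^*Ax is complex. Rescaling u and w by real factors preserves this, so
   x^*Ax lies on a segment, contained in B(A), from W(A) to its conjugate, which
   is the numerical range of the adjoint; if this segment crosses the real axis,
   the crossing point lies between the extreme points of the compact set of real
   points of B(A). *)

Set Implicit Arguments.
Unset Strict Implicit.
Unset Printing Implicit Defensive.

Import Order.TTheory GRing.Theory Num.Theory.
Import numFieldNormedType.Exports.

Local Open Scope classical_set_scope.
Local Open Scope ring_scope.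
Local Open Scope complex_scope.

(** * Quaternions and Hermitian forms *)

Section Quaternions.
Variable R : comNzRingType.
Implicit Types (x y z p q : quat R) (r : R).

Definition qreal r : quat R := Quat r 0 0 0.
(** The squared modulus, kept polynomial in the coordinates so that [ring] applies. *)
Definition qnorm q : R := qre q ^+ 2 + qi q ^+ 2 + qj q ^+ 2 + qk q ^+ 2.
Definition qvec2 q : R := qi q ^+ 2 + qj q ^+ 2 + qk q ^+ 2.

Lemma qaddE x y :
  x + y = Quat (qre x + qre y) (qi x + qi y) (qj x + qj y) (qk x + qk y).
Proof. by []. Qed.

Lemma qmulE x y : x * y = quat_mul x y.
Proof. by []. Qed.

Lemma qoppE x : - x = Quat (- qre x) (- qi x) (- qj x) (- qk x).
Proof. by []. Qed.

Lemma qrealE r : qreal r = Quat r 0 0 0.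
Proof. by []. Qed.

Definition quatE := (qaddE, qmulE, qoppE, qrealE).

Lemma qre_Quat (a b c d : R) : qre (Quat a b c d) = a. Proof. by []. Qed.
Lemma qi_Quat (a b c d : R) : qi (Quat a b c d) = b. Proof. by []. Qed.
Lemma qreN x : qre (- x) = - qre x. Proof. by []. Qed.
Lemma qiN x : qi (- x) = - qi x. Proof. by []. Qed.
Lemma qjN x : qj (- x) = - qj x. Proof. by []. Qed.
Lemma qkN x : qk (- x) = - qk x. Proof. by []. Qed.

Lemma qconjM x y : quat_conj (x * y) = quat_conj y * quat_conj x.
Proof. by rewrite !quatE; congr Quat => /=; ring. Qed.

Lemma qconjD x y : quat_conj (x + y) = quat_conj x + quat_conj y.
Proof. by rewrite !quatE; congr Quat => /=; ring. Qed.

Lemma qconjK : involutive (@quat_conj R).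
Proof. by case=> a b c d; congr Quat; rewrite /= ?opprK. Qed.

Lemma qconj_real r : quat_conj (qreal r) = qreal r.
Proof. by congr Quat; rewrite oppr0. Qed.

Lemma qconj_mul q : quat_conj q * q = qreal (qnorm q).
Proof. by rewrite !quatE; congr Quat => /=; rewrite /qnorm; ring. Qed.

Lemma qnormM x y : qnorm (x * y) = qnorm x * qnorm y.
Proof. by rewrite !quatE /qnorm /=; ring. Qed.

Lemma qnorm_real r : qnorm (qreal r) = r ^+ 2.
Proof. by rewrite /qnorm /= expr0n /= !addr0. Qed.

Lemma qre_conjugate q z : qre (quat_conj q * z * q) = qnorm q * qre z.
Proof. by rewrite !quatE /qnorm /=; ring. Qed.

Lemma qvec2_conjugate q z :
  qvec2 (quat_conj q * z * q) = qnorm q ^+ 2 * qvec2 z.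
Proof. by rewrite !quatE /qvec2 /qnorm /=; ring. Qed.

End Quaternions.

(* Locked, as unification would otherwise unfold these down to coordinates. *)
HB.lock Definition qpair (R : comNzRingType) (n : nat) (A : 'M[quat R]_n)
  (x y : 'cV[quat R]_n) : quat R :=
  (adjmx (@quat_conj R) x *m A *m y) ord0 ord0.

HB.lock Definition hnorm (R : comNzRingType) (n : nat) (x : 'cV[quat R]_n) : R :=
  \sum_i qnorm (x i ord0).

HB.lock Definition qscale (R : comNzRingType) (n : nat) (x : 'cV[quat R]_n)
  (q : quat R) : 'cV[quat R]_n := x *m q%:M.

Section HermitianForms.
Variables (R : comNzRingType) (n : nat).
Implicit Types (A : 'M[quat R]_n) (x y e : 'cV[quat R]_n) (p q : quat R).

Definition qform A x : quat R := qpair A x x.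

Lemma hnorm_sum x : hnorm x = \sum_i qnorm (x i ord0).
Proof. by rewrite hnorm.unlock. Qed.

Lemma qpairE A x y :
  qpair A x y = \sum_i \sum_j quat_conj (x i ord0) * A i j * y j ord0.
Proof.
rewrite qpair.unlock mxE exchange_big /=; apply: eq_bigr => j _.
by rewrite !mxE mulr_suml; apply: eq_bigr => i _; rewrite !mxE.
Qed.

Lemma qscaleE x q i : qscale x q i ord0 = x i ord0 * q.
Proof. by rewrite qscale.unlock mxE big_ord1 mxE eqxx mulr1n. Qed.

Lemma qscaleA x p q : qscale (qscale x p) q = qscale x (p * q).
Proof. by apply/matrixP => i j; rewrite ord1 !qscaleE mulrA. Qed.

Lemma qscale1 x : qscale x 1 = x.
Proof. by apply/matrixP => i j; rewrite ord1 qscaleE mulr1. Qed.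

Lemma qpairDl A x y e : qpair A (x + y) e = qpair A x e + qpair A y e.
Proof.
rewrite !qpairE -big_split; apply: eq_bigr => i _; rewrite -big_split.
by apply: eq_bigr => j _; rewrite mxE qconjD !mulrDl.
Qed.

Lemma qpairDr A x y e : qpair A e (x + y) = qpair A e x + qpair A e y.
Proof.
rewrite !qpairE -big_split; apply: eq_bigr => i _; rewrite -big_split.
by apply: eq_bigr => j _; rewrite mxE !mulrDr.
Qed.

Lemma qpairZ A x y p q :
  qpair A (qscale x p) (qscale y q) = quat_conj p * qpair A x y * q.
Proof.
rewrite !qpairE mulr_sumr mulr_suml; apply: eq_bigr => i _.
rewrite mulr_sumr mulr_suml; apply: eq_bigr => j _.
by rewrite !qscaleE qconjM !mulrA.
Qed.

Lemma qformD A x y :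
  qform A (x + y) = qform A x + (qpair A x y + qpair A y x) + qform A y.
Proof. by rewrite /qform !qpairDl !qpairDr !addrA. Qed.

Lemma qformZ A x q : qform A (qscale x q) = quat_conj q * qform A x * q.
Proof. exact: qpairZ. Qed.

Lemma qform0 A : qform A 0 = 0.
Proof.
have E : (0 : 'cV[quat R]_n) = qscale 0 0.
  by apply/matrixP => i j; rewrite ord1 qscaleE mxE mul0r.
by rewrite E qformZ mulr0.
Qed.

(** Lets the expansion rules for forms serve for squared norms as well. *)
Lemma qform1 x : qform 1%:M x = qreal (hnorm x).
Proof.
rewrite /qform qpair.unlock mulmx1 mxE hnorm_sum.
elim/big_ind2: _ => // [a b c d -> ->|i _]; first by rewrite !quatE /= !addr0.
by rewrite !mxE qconj_mul.
Qed.

Lemma hnormE x : hnorm x = qre (qform 1%:M x).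
Proof. by rewrite qform1. Qed.

Lemma hnormZ x q : hnorm (qscale x q) = qnorm q * hnorm x.
Proof. by rewrite hnormE qformZ qre_conjugate -hnormE. Qed.

Lemma unit_hnorm x :
  adjmx (@quat_conj R) x *m x = 1%:M <-> hnorm x = 1.
Proof.
have {1}-> : adjmx (@quat_conj R) x *m x = (qreal (hnorm x))%:M.
  apply/matrixP => i j; rewrite !ord1 [RHS]mxE eqxx mulr1n -qform1.
  by rewrite /qform qpair.unlock mulmx1.
split=> [/matrixP/(_ ord0 ord0)|->].
  by rewrite !mxE eqxx !mulr1n => -[].
by [].
Qed.

Lemma numrangeHP A z :
  numrange (@quat_conj R) A z <-> exists2 x, hnorm x = 1 & z = qform A x.
Proof.
rewrite /qform qpair.unlock.
by split=> [[x [/unit_hnorm hx ->]]|[x /unit_hnorm hx ->]]; exists x.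
Qed.

End HermitianForms.

Section QuaternionNorm.
Variable R : rcfType.
Implicit Types (x y z p q : quat R) (k : R).

Lemma qnorm_ge0 q : 0 <= qnorm q.
Proof. by rewrite /qnorm !addr_ge0 ?sqr_ge0. Qed.

Lemma qnorm_eq0 q : (qnorm q == 0) = (q == 0).
Proof.
apply/eqP/eqP => [|->]; last by rewrite /qnorm !expr0n /= !addr0.
case: q => a b c d /eqP.
rewrite /qnorm /= !paddr_eq0 ?addr_ge0 ?sqr_ge0// !sqrf_eq0.
by move=> /andP[/andP[/andP[/eqP-> /eqP->] /eqP->] /eqP->].
Qed.

Lemma qnorm_gt0 q : q != 0 -> 0 < qnorm q.
Proof. by move=> q0; rewrite lt_def qnorm_eq0 q0 qnorm_ge0. Qed.

Lemma qvec2_ge0 q : 0 <= qvec2 q.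
Proof. by rewrite /qvec2 !addr_ge0 ?sqr_ge0. Qed.

(* With v the vector part of z, the quaternion p = k - v i satisfies
   v p = p (k i); it vanishes only for v = - k i, where p = j works. *)
Lemma rotate_to_i z k : qvec2 z = k ^+ 2 -> exists2 p, 0 < qnorm p &
  quat_conj p * z * p = Quat (qnorm p * qre z) (qnorm p * k) 0 0.
Proof.
case: z => a b c d; rewrite /qvec2 /= => hk.
have hd : d ^+ 2 = k ^+ 2 - b ^+ 2 - c ^+ 2 by rewrite -hk; ring.
pose p := Quat (k + b) 0 (- d) c.
have [/eqP p0|/qnorm_gt0 p0] := eqVneq p 0; last first.
  exists p => //; rewrite !quatE /qnorm /=; congr Quat => /=.
  - by ring.
  - by ring: hd.
  - by ring: hd.
  - by ring: hd.
move/eqP: p0 => [kb d0 c0].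
exists (Quat 0 0 1 0).
  by rewrite /qnorm /= !expr0n expr1n /= !addr0 add0r ltr01.
have -> : k = - b by apply/eqP; rewrite -addr_eq0 kb.
have -> : d = 0 by apply/eqP; rewrite -oppr_eq0 d0.
by rewrite c0 !quatE /qnorm /=; congr Quat => /=; ring.
Qed.

End QuaternionNorm.

Section HermitianNorm.
Variables (R : rcfType) (n : nat).
Implicit Types (A : 'M[quat R]_n) (x y : 'cV[quat R]_n).

Lemma hnorm_ge0 x : 0 <= hnorm x.
Proof. by rewrite hnorm_sum; apply: sumr_ge0 => i _; exact: qnorm_ge0. Qed.

Lemma hnorm_eq0 x : hnorm x = 0 -> x = 0.
Proof.
move=> /eqP; rewrite hnorm_sum psumr_eq0; last by move=> i _; exact: qnorm_ge0.
move=> /allP h; apply/matrixP => i j; rewrite ord1 mxE; apply/eqP.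
by rewrite -qnorm_eq0; apply: h; rewrite mem_index_enum.
Qed.

Lemma hnorm_neg0 x y : hnorm (x + y) = 0 -> y = qscale x (qreal (-1)).
Proof.
move=> /hnorm_eq0/eqP; rewrite addrC addr_eq0 => /eqP ->.
apply/matrixP => i j; rewrite ord1 qscaleE mxE !quatE; congr Quat => /=; ring.
Qed.

End HermitianNorm.

Section UpperBild.
Variables (R : realType) (n : nat) (A : 'M[quat R]_n).

(** [rotate_to_i] provides [p] for which [x p] has a complex form value; the real factor [s] then
    makes [x p s] a unit vector. *)
Lemma numrangeH_conjugate x k : 0 < hnorm x ->
  qvec2 (qform A x) = (k * hnorm x) ^+ 2 ->
  numrange (@quat_conj R) A (Quat (qre (qform A x) / hnorm x) k 0 0).
Proof.
move=> x0 hk; have [p p0 hp] := rotate_to_i hk.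
pose s := (Num.sqrt (qnorm p * hnorm x))^-1.
have s2 : s ^+ 2 * (qnorm p * hnorm x) = 1.
  by rewrite exprVn sqr_sqrtr ?mulVf ?mulr_ge0 ?ltW// lt0r_neq0 ?mulr_gt0.
apply/numrangeHP; exists (qscale x (p * qreal s)).
  by rewrite hnormZ qnormM qnorm_real (mulrC (qnorm p)) -mulrA.
have sV : s ^+ 2 * qnorm p = (hnorm x)^-1.
  by apply: (mulIf (lt0r_neq0 x0)); rewrite -mulrA s2 mulVf ?lt0r_neq0.
rewrite qformZ qconjM qconj_real -!mulrA (mulrA _ p) (mulrA _ (_ * p)).
rewrite (mulrA (quat_conj p)) hp !quatE.
congr Quat => /=; rewrite ?(mulr0, mul0r, oppr0, subr0, addr0, add0r)//.
  by rewrite -sV; ring.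
transitivity (s ^+ 2 * qnorm p * hnorm x * k); last by ring.
by rewrite sV mulVf ?mul1r ?lt0r_neq0.
Qed.

(** This criterion is homogeneous in [x] and sees only the length of the vector part, so vectors on
    a path need neither unit norm nor a complex form value. *)
Lemma upper_bildP h k : upper_bild A (h +i* k) <-> 0 <= k /\
  exists x, [/\ 0 < hnorm x, qre (qform A x) = h * hnorm x &
                qvec2 (qform A x) = (k * hnorm x) ^+ 2].
Proof.
split=> [[/numrangeHP[x x1 hx] k0]|[k0 [x [x0 hx kx]]]].
  split=> //; exists x; rewrite x1 -hx !mulr1 /qvec2 /= expr0n /= !addr0; split=> //.
split=> //; have := numrangeH_conjugate x0 kx.
by rewrite hx mulfK ?lt0r_neq0.
Qed.

End UpperBild.

(** * Convexity of the upper bild *)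

Section QuadraticPaths.
Variable R : rcfType.
Implicit Types a b c s : R.

(** The shape of a form along a segment: [a] and [c] are the end values and [b] is the sum of both
    cross terms, so no factor 2 appears in the middle. *)
Definition bez a b c s := a * (1 - s) ^+ 2 + b * (s * (1 - s)) + c * s ^+ 2.

(** The same quadratic as a formal polynomial, to which [poly_ivt] applies. *)
Definition bezp a b c : {poly R} :=
  a%:P * (1 - 'X) ^+ 2 + b%:P * ('X * (1 - 'X)) + c%:P * 'X ^+ 2.

Lemma bezpE a b c s : (bezp a b c).[s] = bez a b c s.
Proof. by rewrite /bezp /bez !hornerE. Qed.

Lemma bez0 a b c : bez a b c 0 = a.
Proof. by rewrite /bez; ring. Qed.

Lemma bez1 a b c : bez a b c 1 = c.
Proof. by rewrite /bez; ring. Qed.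

Lemma poly_ivt01 (p : {poly R}) : p.[0] * p.[1] <= 0 ->
  exists s, [/\ 0 <= s, s <= 1 & p.[s] = 0].
Proof.
move=> p01.
have [p0|p0] := lerP p.[0] 0.
  have [p1|p1] := lerP 0 p.[1].
    have [|s /andP[s0 s1] /rootP ps] := poly_ivt (p := p) ler01.
      by rewrite p0 p1.
    by exists s.
  exists 0; split=> //; apply/eqP; rewrite eq_le p0 leNgt; apply/negP => p0'.
  by move: p01; rewrite leNgt nmulr_rgt0 ?p1.
have p1 : p.[1] <= 0 by rewrite -(pmulr_rle0 _ p0).
have [|s /andP[s0 s1] /rootP ps] := poly_ivt (p := - p) ler01.
  by rewrite !hornerN !oppr_le0 oppr_ge0 ltW.
by exists s; split=> //; apply/eqP; rewrite -oppr_eq0 -hornerN; apply/eqP.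
Qed.

End QuadraticPaths.

Section Path.
Variables (R : rcfType) (n : nat).
Implicit Types (A : 'M[quat R]_n) (x e : 'cV[quat R]_n) (q : quat R) (s h k : R).

(** Joins [x q] to [e]. The factor [q] merely scales the real part and the length of the vector part
    of the form at the first end, while it leaves freedom in the cross term. *)
Definition qpath x q e s := qscale x (q * qreal (1 - s)) + qscale e (qreal s).

Definition qcross A x q e := quat_conj q * qpair A x e + qpair A e x * q.

Lemma qform_path A x q e s : let C := quat_conj q * qform A x * q in
  let X := qcross A x q e in let E := qform A e in
  qform A (qpath x q e s) =
  Quat (bez (qre C) (qre X) (qre E) s) (bez (qi C) (qi X) (qi E) s)
       (bez (qj C) (qj X) (qj E) s) (bez (qk C) (qk X) (qk E) s).
Proof.
move=> /=; rewrite /qpath qformD.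
rewrite !qformZ.
rewrite !qpairZ.
rewrite !qconjM.
rewrite !qconj_real /qcross.
move: (qform A x) (qpair A x e) (qpair A e x) (qform A e) => F a b E.
by rewrite !quatE /bez; congr Quat => /=; ring.
Qed.

Lemma hnorm_path x q e s : hnorm (qpath x q e s) =
  bez (qnorm q * hnorm x) (qre (qcross 1%:M x q e)) (hnorm e) s.
Proof. by rewrite hnormE qform_path qre_Quat qre_conjugate -!hnormE. Qed.

(** If the path meets 0, then [e s = - x q (1 - s)], and the form and the norm of both sides can be
    compared. *)
Lemma hnorm_path_eq0 A x q e s : hnorm (qpath x q e s) = 0 ->
  let w := qnorm q * (1 - s) ^+ 2 in
  [/\ s ^+ 2 * hnorm e = w * hnorm x,
      s ^+ 2 * qre (qform A e) = w * qre (qform A x) &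
      (s ^+ 2) ^+ 2 * qvec2 (qform A e) = w ^+ 2 * qvec2 (qform A x)].
Proof.
move=> /hnorm_neg0 exs w; rewrite qscaleA in exs.
have wE : qnorm (q * qreal (1 - s) * qreal (-1)) = w.
  by rewrite !qnormM !qnorm_real sqrrN expr1n mulr1.
have hF := congr1 (qform A) exs; split.
- by have := congr1 (@hnorm R n) exs; rewrite !hnormZ qnorm_real wE.
- have := congr1 (@qre R) hF.
  by rewrite !qformZ !qre_conjugate wE qnorm_real.
- have := congr1 (@qvec2 R) hF.
  by rewrite !qformZ !qvec2_conjugate wE qnorm_real.
Qed.

End Path.

Section Convexity.
Variables (R : rcfType) (n : nat) (A : 'M[quat R]_n).
Implicit Types (x e y : 'cV[quat R]_n) (q : quat R).

(** Put a = x^*Ae and c = e^*Ax. For q = a - conj c the cross term is |a|^2 - |c|^2; if this q is 0,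
    then q = 1 gives conj c + c. *)
Lemma real_cross x e : exists q, [/\ q != 0, qi (qcross A x q e) = 0,
  qj (qcross A x q e) = 0 & qk (qcross A x q e) = 0].
Proof.
pose q := qpair A x e - quat_conj (qpair A e x); rewrite /qcross.
have [/eqP q0|q0] := eqVneq q 0.
  move: q0; rewrite subr_eq0 => /eqP ->; exists 1; rewrite oner_eq0.
  by move: (qpair A e x) => c; rewrite !quatE; split=> //=; ring.
exists q; rewrite /q in q0 *; split=> //.
all: by move: (qpair A x e) (qpair A e x) => a c; rewrite !quatE /=; ring.
Qed.

Lemma qcrossN x q e : qcross A x (- q) e = - qcross A x q e.
Proof. by rewrite /qcross !quatE; congr Quat => /=; ring. Qed.

(** The real part of [quat_conj q * z] is the Euclidean inner product in dimension 4, and [z i] is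
    orthogonal to [z]. *)
Lemma orthogonal_quat (z : quat R) : exists2 q, q != 0 & qre (quat_conj q * z) = 0.
Proof.
have [->|z0] := eqVneq z 0; first by exists 1; rewrite ?oner_eq0 ?mulr0.
exists (z * Quat 0 1 0 0); last by rewrite !quatE /=; ring.
rewrite -qnorm_eq0 qnormM mulf_neq0 ?qnorm_eq0//.
by apply/eqP => -[] /eqP; rewrite oner_eq0.
Qed.

Lemma level_ivt h k x e : 0 < hnorm x -> 0 < hnorm e ->
  qre (qform A x) = h * hnorm x -> qre (qform A e) = h * hnorm e ->
  qvec2 (qform A x) <= (k * hnorm x) ^+ 2 ->
  (k * hnorm e) ^+ 2 <= qvec2 (qform A e) ->
  exists y, [/\ 0 < hnorm y, qre (qform A y) = h * hnorm y &
                qvec2 (qform A y) = (k * hnorm y) ^+ 2].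
Proof.
move=> x0 e0 hx he kx ke.
(* Orthogonality to this quaternion says that the cross term of the form of A - h has real part 0,
   which keeps the whole path at height [h]. *)
have [q q0 hq] := orthogonal_quat
  (qpair A x e + quat_conj (qpair A e x)
   - qreal h * (qpair 1%:M x e + quat_conj (qpair 1%:M e x))).
have X0 : qre (qcross A x q e) = h * qre (qcross 1%:M x q e).
  apply/eqP; rewrite -subr_eq0 -hq /qcross; apply/eqP.
  move: (qpair A x e) (qpair A e x) (qpair 1%:M x e) (qpair 1%:M e x) => a b c d.
  by rewrite !quatE /=; ring.
have hy s : qre (qform A (qpath x q e s)) = h * hnorm (qpath x q e s).
  by rewrite hnorm_path qform_path qre_Quat qre_conjugate hx he X0 /bez; ring.
pose C := quat_conj q * qform A x * q; pose X := qcross A x q e; pose E := qform A e.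
pose N := bezp (qnorm q * hnorm x) (qre (qcross 1%:M x q e)) (hnorm e).
pose p := bezp (qi C) (qi X) (qi E) ^+ 2 + bezp (qj C) (qj X) (qj E) ^+ 2 +
          bezp (qk C) (qk X) (qk E) ^+ 2 - (k%:P * N) ^+ 2.
have pE s : p.[s] = qvec2 (qform A (qpath x q e s)) -
                    (k * hnorm (qpath x q e s)) ^+ 2.
  have hE (a b c d : {poly R}) :
    (a ^+ 2 + b ^+ 2 + c ^+ 2 - (k%:P * d) ^+ 2).[s] =
    a.[s] ^+ 2 + b.[s] ^+ 2 + c.[s] ^+ 2 - (k * d.[s]) ^+ 2.
    by rewrite !(hornerD, hornerN, horner_exp, hornerM, hornerC).
  by rewrite qform_path hnorm_path /p hE !bezpE.
have [|s [s0 s1]] := @poly_ivt01 _ p.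
  have -> : p.[0] = qnorm q ^+ 2 * (qvec2 (qform A x) - (k * hnorm x) ^+ 2).
    rewrite mulrBr -qvec2_conjugate pE qform_path hnorm_path !bez0.
    by rewrite /qvec2 /=; congr (_ - _); ring.
  have -> : p.[1] = qvec2 (qform A e) - (k * hnorm e) ^+ 2.
    by rewrite pE qform_path hnorm_path !bez1.
  rewrite mulr_le0_ge0 ?subr_ge0// mulr_ge0_le0 ?sqr_ge0// subr_le0//.
rewrite pE => /eqP; rewrite subr_eq0 => /eqP ps.
have [y0|] := boolP (0 < hnorm (qpath x q e s)); first by exists (qpath x q e s).
(* If the path vanishes at the root, [e] is a right multiple of [x]; the upper bound at [x] carries
   over to [e], which then attains equality. *)
rewrite lt_def hnorm_ge0 andbT negbK => /eqP /(hnorm_path_eq0 A)[Nxe _ Vxe].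
set w := qnorm q * (1 - s) ^+ 2 in Nxe Vxe.
have s_gt0 : 0 < s.
  rewrite lt_def s0 andbT; apply/eqP => s_eq0; move: Nxe.
  rewrite /w s_eq0 expr0n /= mul0r subr0 expr1n mulr1 => /esym/eqP.
  by rewrite mulf_eq0 qnorm_eq0 (negPf q0) (gt_eqF x0).
exists e; split=> //; apply/eqP; rewrite eq_le ke andbT.
have s4 : 0 < (s ^+ 2) ^+ 2 by rewrite !exprn_gt0.
rewrite -(ler_pM2l s4) Vxe -exprMn mulrCA Nxe mulrCA exprMn.
by rewrite ler_wpM2l ?sqr_ge0.
Qed.

End Convexity.

Section SegmentBounds.
Variables (R : rcfType) (n : nat) (A : 'M[quat R]_n).
Variables (x e : 'cV[quat R]_n) (h1 h2 k1 k2 t : R).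
Hypotheses (x1 : hnorm x = 1) (e1 : hnorm e = 1).
Hypotheses (hx : qform A x = Quat h1 k1 0 0) (he : qform A e = Quat h2 k2 0 0).
Hypotheses (k1_ge0 : 0 <= k1) (k2_ge0 : 0 <= k2) (t_ge0 : 0 <= t) (t_le1 : t <= 1).
Let h : R := (1 - t) * h1 + t * h2.
Let k : R := (1 - t) * k1 + t * k2.
(** The line through the two points, made homogeneous, is the linear map (H, N) -> k1 N + (k2 - k1)
    / (h2 - h1) (H - h1 N). This is its value at the cross terms of the form and of the norm. *)
Let excess q := k1 * qre (qcross 1%:M x q e) +
  (k2 - k1) / (h2 - h1) * (qre (qcross A x q e) - h1 * qre (qcross 1%:M x q e)).

Let k_ge0 : 0 <= k.
Proof. by rewrite addr_ge0 ?mulr_ge0 ?subr_ge0. Qed.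

Let excessN q : excess (- q) = - excess q.
Proof. by rewrite /excess !qcrossN !qreN; ring. Qed.

(** The end values of [p] have product at most 0 because [h] lies between [h1] and [h2]; at a root
    of [p], the slope of the segment converts [h] into [k]. *)
Lemma path_crossing q : q != 0 -> h1 != h2 -> exists s, let y := qpath x q e s in
  [/\ 0 <= s * (1 - s), 0 < hnorm y, qre (qform A y) = h * hnorm y &
      k * hnorm y = qnorm q * k1 * (1 - s) ^+ 2 + k2 * s ^+ 2 +
                    s * (1 - s) * excess q].
Proof.
move=> q0 h12; have hd : h2 - h1 != 0 by rewrite subr_eq0 eq_sym.
pose X := qre (qcross A x q e); pose M := qre (qcross 1%:M x q e).
have reE s : qre (qform A (qpath x q e s)) = bez (qnorm q * h1) X h2 s.
  by rewrite qform_path qre_Quat qre_conjugate hx he.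
have hnE s : hnorm (qpath x q e s) = bez (qnorm q) M 1 s.
  by rewrite hnorm_path x1 e1 mulr1.
pose p := bezp (qnorm q * (h1 - h)) (X - h * M) (h2 - h).
have pE s : p.[s] = qre (qform A (qpath x q e s)) - h * hnorm (qpath x q e s).
  by rewrite bezpE reE hnE /bez; ring.
have [|s [s0 s1]] := @poly_ivt01 _ p.
  rewrite !bezpE bez0 bez1.
  have -> : qnorm q * (h1 - h) * (h2 - h) =
            - (qnorm q * (t * (1 - t)) * (h2 - h1) ^+ 2) by rewrite /h; ring.
  by rewrite oppr_le0 mulr_ge0 ?sqr_ge0// mulr_ge0 ?qnorm_ge0// mulr_ge0 ?subr_ge0.
rewrite pE => /eqP; rewrite subr_eq0 => /eqP ps; exists s => y.
split=> //; first by rewrite mulr_ge0 ?subr_ge0.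
  (* A vanishing [y] makes the ends proportional: either [h1 = h2], or [s = 0] and [y = x q] is
     nonzero. *)
  rewrite lt_def hnorm_ge0 andbT; apply/eqP => yn0.
  have [] := hnorm_path_eq0 A yn0.
  rewrite x1 e1 !mulr1 hx he !qre_Quat => <- /eqP.
  rewrite -subr_eq0 -mulrBr mulf_eq0 (negPf hd) orbF expf_eq0.
  move=> /= /eqP s_eq0 _; move: yn0.
  by rewrite /y hnE s_eq0 bez0 => /eqP; rewrite qnorm_eq0 (negPf q0).
apply: (mulfI hd).
have -> : (h2 - h1) * (k * hnorm y) =
    (h2 - h1) * k1 * hnorm y + (k2 - k1) * (h * hnorm y - h1 * hnorm y).
  by rewrite /h /k; ring.
by rewrite -ps reE hnE /bez /excess -/X -/M; field.
Qed.

(** With a real cross term, the vector part along the path is a sum of vectors of lengths |q|^2 k1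
    (1 - s)^2 and k2 s^2. By [path_crossing], the sum of these lengths is at most k |y|^2 once
    [excess q] is nonnegative. *)
Lemma segment_lower : exists y, [/\ 0 < hnorm y, qre (qform A y) = h * hnorm y &
  qvec2 (qform A y) <= (k * hnorm y) ^+ 2].
Proof.
(* At equal heights the end with the smaller [k] serves. *)
have [h12|h12] := eqVneq h1 h2.
  have hE : h = h1 by rewrite /h -h12; ring.
  have [k12|k12] := lerP k1 k2; [exists x|exists e];
    rewrite ?x1 ?e1 ?hx ?he hE ?qre_Quat -?h12 mulr1; split=> //;
    rewrite /qvec2 /= expr0n /= !addr0 mulr1 ler_sqr //.
    have kE : k - k1 = t * (k2 - k1) by rewrite /k; ring.
    by rewrite -subr_ge0 kE mulr_ge0 ?subr_ge0.
  have kE : k - k2 = (1 - t) * (k1 - k2) by rewrite /k; ring.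
  by rewrite -subr_ge0 kE mulr_ge0 ?subr_ge0//; exact: ltW.
have [q [q0 qi0 qj0 qk0 dq]] : exists q, [/\ q != 0, qi (qcross A x q e) = 0,
    qj (qcross A x q e) = 0, qk (qcross A x q e) = 0 & 0 <= excess q].
  have [q [q0 qi0 qj0 qk0]] := real_cross A x e.
  have [dq|dq] := lerP 0 (excess q); first by exists q.
  exists (- q); rewrite oppr_eq0 excessN oppr_ge0 qcrossN qiN qjN qkN qi0 qj0 qk0.
  by rewrite !oppr0; split=> //; exact: ltW.
have [s [s01 y0 yh yk]] := path_crossing q0 h12.
exists (qpath x q e s); split=> //.
pose C := quat_conj q * qform A x * q.
have C2 : qvec2 C = (qnorm q * k1) ^+ 2.
  by rewrite qvec2_conjugate exprMn hx /qvec2 /= expr0n /= !addr0.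
have Ci : qi C <= qnorm q * k1.
  apply: le_trans (ler_norm _) _.
  rewrite -(ler_pXn2r (n := 2)) ?nnegrE ?mulr_ge0 ?qnorm_ge0// real_normK ?num_real//.
  by rewrite -C2 /qvec2 -addrA lerDl addr_ge0 ?sqr_ge0.
pose a := (1 - s) ^+ 2; pose b := s ^+ 2.
apply: le_trans (_ : (qnorm q * k1 * a + k2 * b) ^+ 2 <= _).
  rewrite qform_path -/C qi0 qj0 qk0 he -subr_ge0.
  (* The squared triangle inequality: the first bracket vanishes by [C2], the second is nonnegative
     by [Ci]. *)
  have -> : (qnorm q * k1 * a + k2 * b) ^+ 2 -
     qvec2 (Quat (bez (qre C) (qre (qcross A x q e)) h2 s) (bez (qi C) 0 k2 s)
                 (bez (qj C) 0 0 s) (bez (qk C) 0 0 s)) =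
     ((qnorm q * k1) ^+ 2 - qvec2 C) * a ^+ 2 +
     2 * (a * b * k2 * (qnorm q * k1 - qi C)).
    by rewrite /qvec2 /bez /a /b /=; ring.
  rewrite C2 subrr mul0r add0r mulr_ge0// mulr_ge0 ?subr_ge0//.
  by rewrite mulr_ge0// mulr_ge0 ?sqr_ge0.
rewrite ler_pXn2r ?nnegrE //.
- by rewrite yk lerDl mulr_ge0.
- by rewrite addr_ge0// mulr_ge0 ?sqr_ge0// mulr_ge0 ?qnorm_ge0.
- by rewrite mulr_ge0 ?hnorm_ge0.
Qed.

(** For q = 1 and q = -1 the vector parts at the ends stay on the i-axis, so the i-coordinate alone
    reaches k |y|^2 once [excess q <= qi (qcross A x q e)]. Both sides are odd in [q], so one sign
    works. *)
Lemma segment_upper : exists y, [/\ 0 < hnorm y, qre (qform A y) = h * hnorm y &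
  (k * hnorm y) ^+ 2 <= qvec2 (qform A y)].
Proof.
have [h12|h12] := eqVneq h1 h2.
  have hE : h = h1 by rewrite /h -h12; ring.
  have [k12|k12] := lerP k1 k2; [exists e|exists x];
    rewrite ?x1 ?e1 ?hx ?he hE ?qre_Quat -?h12 mulr1; split=> //;
    rewrite /qvec2 /= expr0n /= !addr0 mulr1 ler_sqr //.
    have kE : k2 - k = (1 - t) * (k2 - k1) by rewrite /k; ring.
    by rewrite -subr_ge0 kE mulr_ge0 ?subr_ge0.
  have kE : k1 - k = t * (k1 - k2) by rewrite /k; ring.
  by rewrite -subr_ge0 kE mulr_ge0 ?subr_ge0//; exact: ltW.
have [q [q0 qn dq cq]] : exists q, [/\ q != 0, qnorm q = 1,
    excess q <= qi (qcross A x q e) & quat_conj q * qform A x * q = qform A x].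
  have [dq|dq] := lerP (excess 1) (qi (qcross A x 1 e)).
    exists 1; rewrite oner_eq0; split => //.
      by rewrite /qnorm /= expr1n !expr0n /= !addr0.
    by rewrite mulr1 hx !quatE; congr Quat => /=; ring.
  exists (- 1); rewrite oppr_eq0 oner_eq0 excessN qcrossN; split=> //.
  - by rewrite /qnorm /= !oppr0 sqrrN expr1n !expr0n /= !addr0.
  - by rewrite qiN lerN2 ltW.
  - by rewrite hx !quatE; congr Quat => /=; ring.
have [s [s01 y0 yh yk]] := path_crossing q0 h12.
exists (qpath x q e s); split=> //.
have ykq : k * hnorm (qpath x q e s) <= qi (qform A (qpath x q e s)).
  rewrite yk qn qform_path cq hx he qi_Quat.
  have -> : bez k1 (qi (qcross A x q e)) k2 s =
      (1 * k1 * (1 - s) ^+ 2 + k2 * s ^+ 2 + s * (1 - s) * excess q) +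
      s * (1 - s) * (qi (qcross A x q e) - excess q) by rewrite /bez; ring.
  by rewrite lerDl mulr_ge0 ?subr_ge0.
apply: le_trans (_ : qi (qform A (qpath x q e s)) ^+ 2 <= _).
  have yk0 : 0 <= k * hnorm (qpath x q e s) by rewrite mulr_ge0 ?hnorm_ge0.
  by rewrite ler_pXn2r ?nnegrE ?(le_trans yk0 ykq).
by rewrite /qvec2 -addrA lerDl addr_ge0 ?sqr_ge0.
Qed.

End SegmentBounds.

Section UpperBildConvex.
Variables (R : realType) (n : nat) (A : 'M[quat R]_n).

Lemma upper_bild_segment (h1 k1 h2 k2 t : R) :
  upper_bild A (h1 +i* k1) -> upper_bild A (h2 +i* k2) -> 0 <= t -> t <= 1 ->
  upper_bild A (((1 - t) * h1 + t * h2) +i* ((1 - t) * k1 + t * k2)).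
Proof.
move=> [/numrangeHP[x x1 hx] k1_ge0] [/numrangeHP[e e1 he] k2_ge0] t0 t1.
have [y [y0 yh yk]] := segment_lower x1 e1 (esym hx) (esym he) k1_ge0 k2_ge0 t0 t1.
have [z [z0 zh zk]] := segment_upper x1 e1 (esym hx) (esym he) k1_ge0 k2_ge0 t0 t1.
apply/upper_bildP; split.
  by rewrite addr_ge0 ?mulr_ge0 ?subr_ge0.
exact: level_ivt yk zk.
Qed.

Lemma upper_bild_convex : @convex_set R (Rcomplex R) (upper_bild A).
Proof.
move=> [h1 k1] [h2 k2] l; rewrite !inE => z1 z2.
(* [conv l] puts the weight [l] on its first point, hence the swapped order. *)
have := upper_bild_segment z2 z1 (ge0 l) (le1 l) => /(_ isT isT).
by rewrite [_ * h2 + _]addrC [_ * k2 + _]addrC.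
Qed.

End UpperBildConvex.

(** * Complex matrices as quaternionic matrices *)

Section ComplexVectors.
Variables (R : realType) (n : nat).
Implicit Types (A : 'M[R[i]]_n) (u w : 'cV[R[i]]_n) (a b : R[i]).
Local Notation qc := (@quat_of_complex R).
Local Notation qj1 := (Quat 0 0 1 0 : quat R).

Definition quatcv u : 'cV[quat R]_n := map_mx qc u.

Definition cpair A u w : R[i] := (adjmx (@conjc R) u *m A *m w) ord0 ord0.
Definition cform A u : R[i] := cpair A u u.

Lemma qcD a b : qc (a + b) = qc a + qc b.
Proof. by case: a b => [a0 a1] [b0 b1]; rewrite quatE /qc /= !addr0. Qed.

Lemma qcM a b : qc (a * b) = qc a * qc b.
Proof.
by case: a b => [a0 a1] [b0 b1]; rewrite quatE /qc; congr Quat => /=; ring.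
Qed.

Lemma qc_conj a : qc (conjc a) = quat_conj (qc a).
Proof. by case: a => a0 a1; congr Quat; rewrite /= ?oppr0. Qed.

(** Through this identity the part [w j] of a vector contributes a value of the form of the
    adjoint. *)
Lemma qc_conj_j a : quat_conj qj1 * qc a * qj1 = qc (conjc a).
Proof. by case: a => a0 a1; rewrite !quatE /qc; congr Quat => /=; ring. Qed.

Lemma qc_sum (I : Type) (r : seq I) (F : I -> R[i]) :
  qc (\sum_(i <- r) F i) = \sum_(i <- r) qc (F i).
Proof. by apply: big_morph => //; exact: qcD. Qed.

Lemma cpairE A u w :
  cpair A u w = \sum_i \sum_j conjc (u i ord0) * A i j * w j ord0.
Proof.
rewrite /cpair mxE exchange_big /=; apply: eq_bigr => j _.
by rewrite !mxE mulr_suml; apply: eq_bigr => i _; rewrite !mxE.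
Qed.

Lemma qpair_quatcv A u w :
  qpair (quatmx A) (quatcv u) (quatcv w) = qc (cpair A u w).
Proof.
rewrite qpairE cpairE qc_sum; apply: eq_bigr => i _.
rewrite qc_sum; apply: eq_bigr => j _.
by rewrite !mxE !qcM qc_conj.
Qed.

Lemma qform_quatcv A u : qform (quatmx A) (quatcv u) = qc (cform A u).
Proof. exact: qpair_quatcv. Qed.

Lemma cform_adj A u : cform (adjmx (@conjc R) A) u = conjc (cform A u).
Proof.
rewrite /cform !cpairE exchange_big rmorph_sum /=; apply: eq_bigr => i _.
rewrite rmorph_sum; apply: eq_bigr => j _.
rewrite !mxE; move: (u i ord0) (A i j) (u j ord0) => [a0 a1] [b0 b1] [c0 c1].
by simpc; congr Complex; ring.
Qed.

Lemma cform1 u : cform 1%:M u = (hnorm (quatcv u))%:C.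
Proof.
have := qform_quatcv 1%:M u.
have -> : quatmx (1%:M : 'M[R[i]]_n) = 1%:M.
  by apply/matrixP => i j; rewrite !mxE; case: eqP.
by rewrite qform1 qrealE; case: (cform _ _) => a b [-> <-].
Qed.

Lemma unit_quatcv u : adjmx (@conjc R) u *m u = 1%:M <-> hnorm (quatcv u) = 1.
Proof.
have -> : adjmx (@conjc R) u *m u = ((hnorm (quatcv u))%:C)%:M.
  apply/matrixP => i j.
  by rewrite !ord1 [RHS]mxE eqxx mulr1n -cform1 /cform /cpair mulmx1.
split=> [/matrixP/(_ ord0 ord0)|->].
  by rewrite !mxE eqxx !mulr1n => -[].
by [].
Qed.

Lemma numrangeCP A z :
  numrangeC A z <-> exists2 u, hnorm (quatcv u) = 1 & z = cform A u.
Proof.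
by split=> [[u [/unit_quatcv hu ->]]|[u /unit_quatcv hu ->]]; exists u.
Qed.

Lemma numrangeC_normalize A u : 0 < hnorm (quatcv u) ->
  numrangeC A ((complex.Re (cform A u) / hnorm (quatcv u)) +i*
               (complex.Im (cform A u) / hnorm (quatcv u))).
Proof.
set N := hnorm _ => N0; pose s := (Num.sqrt N)^-1.
have s2 : s ^+ 2 = N^-1 by rewrite exprVn sqr_sqrtr ?ltW.
pose v := \col_i (s%:C * u i ord0).
have vE : quatcv v = qscale (quatcv u) (qreal s).
  apply/matrixP => i j; rewrite ord1 qscaleE !mxE.
  by case: (u i ord0) => a b; rewrite !quatE; congr Quat => /=; ring.
apply/numrangeCP; exists v.
  by rewrite vE hnormZ qnorm_real s2 mulVf ?gt_eqF.
have := qform_quatcv A v; rewrite vE qformZ qform_quatcv qconj_real.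
case: (cform A u) => a b; case: (cform A v) => c d.
rewrite !quatE /= => -[<- <- _ _].
by rewrite -s2; congr Complex; ring.
Qed.

Lemma complex_decomposition (x : 'cV[quat R]_n) :
  exists u w, x = quatcv u + qscale (quatcv w) qj1.
Proof.
exists (\col_i (qre (x i ord0) +i* qi (x i ord0))).
exists (\col_i (qj (x i ord0) +i* qk (x i ord0))).
apply/matrixP => i j; rewrite ord1 mxE qscaleE !mxE.
by case: (x i ord0) => a b c d; rewrite !quatE /qc; congr Quat => /=; ring.
Qed.

Lemma qform_quatcv_j A w :
  qform (quatmx A) (qscale (quatcv w) qj1) = qc (cform (adjmx (@conjc R) A) w).
Proof. by rewrite qformZ qform_quatcv qc_conj_j cform_adj. Qed.

Lemma hnorm_quatcv_j w : hnorm (qscale (quatcv w) qj1) = hnorm (quatcv w).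
Proof. by rewrite hnormZ /qnorm /= expr1n !expr0n /= !addr0 add0r mul1r. Qed.

(** Products of a complex number with j, on either side, lie in the span of j and k. *)
Lemma qpair_jk A u w :
  let X := qpair (quatmx A) (quatcv u) (qscale (quatcv w) qj1) +
           qpair (quatmx A) (qscale (quatcv w) qj1) (quatcv u) in qre X = 0 /\ qi X = 0.
Proof.
move=> X.
rewrite /X -[quatcv u]qscale1 !qpairZ !qpair_quatcv.
case: (cpair A u w) => a b; case: (cpair A w u) => c d.
by rewrite !quatE; split=> /=; ring.
Qed.

End ComplexVectors.

Section HullInclusion.
Variables (R : realType).

Lemma complex_conv (l : {i01 R}) (a b c d : R) :
  (conv l (a +i* b : convex_lmodType (Rcomplex R)) (c +i* d) : R[i]) =
  (l%:num * a + (1 - l%:num) * c) +i* (l%:num * b + (1 - l%:num) * d).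
Proof. by []. Qed.

Lemma convex_complex (S : set R[i]) (a b c d t : R) :
  @convex_set R (Rcomplex R) S -> 0 <= t -> t <= 1 ->
  S (a +i* b) -> S (c +i* d) ->
  S ((t * a + (1 - t) * c) +i* (t * b + (1 - t) * d)).
Proof.
move=> cS t0 t1 Sab Scd.
have := cS (a +i* b) (c +i* d) (Itv01 t0 t1); rewrite !inE complex_conv /=.
by apply.
Qed.

Lemma convex_combination (S : set R[i]) (p q z : R[i]) (t : R) :
  @convex_set R (Rcomplex R) S -> 0 <= t -> t <= 1 -> S p -> S q ->
  complex.Re z = t * complex.Re p + (1 - t) * complex.Re q ->
  complex.Im z = t * complex.Im p + (1 - t) * complex.Im q -> S z.
Proof.
case: p q z => [a b] [c d] [h k] cS t0 t1 Sp Sq /= -> ->.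
exact: convex_complex.
Qed.

(** The weights [- b1] and [a1] cancel the imaginary parts and give a real point. The target lies
    between that point and the first one, with a weight forced by the imaginary parts. *)
Lemma convex_cone_combination (S : set R[i]) (a0 a1 b0 b1 s t : R) :
  @convex_set R (Rcomplex R) S -> 0 < s -> 0 <= t -> s + t = 1 -> 0 < a1 -> b1 < 0 ->
  0 <= a1 + b1 -> S ((a0 / s) +i* (a1 / s)) ->
  S ((- b1 * a0 + a1 * b0) / (- b1 * s + a1 * t))%:C -> S ((a0 + b0) +i* (a1 + b1)).
Proof.
move=> cS s0 t0 st a1_gt0 b1_lt0 ab1 Sp Sr.
have D0 : 0 < - b1 * s + a1 * t.
  by rewrite ltr_pwDl ?mulr_gt0 ?oppr_gt0// mulr_ge0 // ltW.
have D : 1 - s * (a1 + b1) / a1 = (- b1 * s + a1 * t) / a1.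
  by rewrite -[X in X - _]st; field; rewrite gt_eqF.
apply: (convex_combination (t := s * (a1 + b1) / a1) cS _ _ Sp Sr) => /=.
- by rewrite divr_ge0 ?mulr_ge0// ltW.
- by rewrite -subr_ge0 D divr_ge0 // ltW.
- by rewrite D; field; rewrite !gt_eqF.
- by rewrite D mulr0 addr0; field; rewrite !gt_eqF.
Qed.

Variables (n : nat) (A : 'M[R[i]]_n) (S : set R[i]).
Hypothesis convexS : @convex_set R (Rcomplex R) S.
Hypothesis rangeS : upper_numrangeC A `<=` S.
Hypothesis range_adjS : upper_numrangeC (adjmx (@conjc R) A) `<=` S.
Hypothesis realS : forall r, real_bild (quatmx A) r -> S r%:C.

Lemma upper_bild_sub_convex : upper_bild (quatmx A) `<=` S.
Proof.
move=> [h k] [/numrangeHP[x x1 hx] k0]; rewrite /upper_half /= in k0.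
have [u [w xE]] := complex_decomposition x.
set xj := qscale _ _ in xE; pose xu := quatcv u.
set M := quatmx A in hx.
have [X0 X1] := qpair_jk A u w; have [Y0 _] := qpair_jk 1%:M u w.
rewrite -/xj -/xu -/M in X0 X1 Y0.
move aE : (cform A u) => a; move bE : (cform (adjmx (@conjc R) A) w) => b.
case: a aE => a0 a1 aE; case: b bE => b0 b1 bE.
have Fu : qform M xu = Quat a0 a1 0 0 by rewrite qform_quatcv aE.
have Fj : qform M xj = Quat b0 b1 0 0 by rewrite qform_quatcv_j bE.
set X := _ + _ in X0 X1.
(* The total and both diagonal terms are complex, so the cross term, lying in the span of j and k,
   must vanish. *)
have [hE kE Xz] : [/\ h = a0 + b0, k = a1 + b1 & X = 0].
  move: hx; rewrite xE qformD -/X Fu Fj; case: X X0 X1 => x0 x1' x2 x3 /= -> ->.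
  rewrite !quatE /quat_of_complex /= => -[-> ->].
  by rewrite !addr0 !add0r => <- <-.
have Nj : hnorm xj = hnorm (quatcv w) by exact: hnorm_quatcv_j.
rewrite -/xu in xE; clearbody xj.
have Q1 : quatmx (1%:M : 'M[R[i]]_n) = 1%:M.
  by apply/matrixP => i j; rewrite !mxE; case: eqP.
have hnormab (al be : R) : hnorm (qscale xu (qreal al) + qscale xj (qreal be)) =
    al ^+ 2 * hnorm xu + be ^+ 2 * hnorm xj.
  rewrite hnormE qformD !qform1 !hnormZ !qnorm_real !qpairZ !qconj_real.
  move: Y0; rewrite Q1.
  move: (qpair _ xu xj) (qpair _ xj xu) => Y Z; rewrite !quatE /= => YZ.
  transitivity (al ^+ 2 * hnorm xu + be ^+ 2 * hnorm xj +
                al * be * (qre Y + qre Z)); first ring.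
  by rewrite YZ mulr0 addr0.
have Nab : hnorm xu + hnorm xj = 1.
  have := hnormab 1 1.
  by rewrite (qscale1 xu : qscale xu (qreal 1) = xu)
     (qscale1 xj : qscale xj (qreal 1) = xj) -xE x1 !expr1n !mul1r => <-.
have Fab (al be : R) : qform M (qscale xu (qreal al) + qscale xj (qreal be)) =
    Quat (al ^+ 2 * a0 + be ^+ 2 * b0) (al ^+ 2 * a1 + be ^+ 2 * b1) 0 0.
  rewrite qformD !qformZ !qpairZ !qconj_real Fu Fj.
  have -> : qreal al * qpair M xu xj * qreal be + qreal be * qpair M xj xu * qreal al =
            qreal (al * be) * X.
    rewrite /X -/M -/xu; move: (qpair _ xu xj) (qpair _ xj xu) => Y Z.
    by rewrite !quatE; congr Quat => /=; ring.
  by rewrite Xz mulr0 addr0 !quatE; congr Quat => /=; ring.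
(* A real rescaling of the two parts whose form value is real yields a real point of the bild, hence
   a point of [S]. *)
have BR (al be : R) : 0 < al ^+ 2 * hnorm xu + be ^+ 2 * hnorm xj ->
    al ^+ 2 * a1 + be ^+ 2 * b1 = 0 ->
    S ((al ^+ 2 * a0 + be ^+ 2 * b0) /
       (al ^+ 2 * hnorm xu + be ^+ 2 * hnorm xj))%:C.
  move=> N0 im0; apply: realS.
  have [] : upper_bild M ((al ^+ 2 * a0 + be ^+ 2 * b0) /
                          (al ^+ 2 * hnorm xu + be ^+ 2 * hnorm xj))%:C.
    apply/upper_bildP; split=> //.
    exists (qscale xu (qreal al) + qscale xj (qreal be)).
    rewrite hnormab Fab im0 divfK ?gt_eqF//; split=> //.
    by rewrite /qvec2 /= mul0r expr0n /= !addr0.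
  by [].
have Zu : hnorm xu = 0 -> a0 = 0 /\ a1 = 0.
  by move=> /hnorm_eq0 xu0; move: Fu; rewrite xu0 qform0 => -[<- <-].
have Zj : hnorm xj = 0 -> b0 = 0 /\ b1 = 0.
  by move=> /hnorm_eq0 xj0; move: Fj; rewrite xj0 qform0 => -[<- <-].
have Su : 0 < hnorm xu -> 0 <= a1 -> S ((a0 / hnorm xu) +i* (a1 / hnorm xu)).
  move=> N0 a1_ge0; apply: rangeS; split; last first.
    by rewrite /upper_half /= divr_ge0 // ltW.
  by have := numrangeC_normalize A N0; rewrite aE.
have Sj : 0 < hnorm xj -> 0 <= b1 -> S ((b0 / hnorm xj) +i* (b1 / hnorm xj)).
  move=> N0 b1_ge0; apply: range_adjS; split; last first.
    by rewrite /upper_half /= divr_ge0 // ltW.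
  have := numrangeC_normalize (adjmx (@conjc R) A) (u := w).
  by rewrite bE -Nj; apply.
have xu_ge0 := hnorm_ge0 xu; have xj_ge0 := hnorm_ge0 xj.
rewrite hE kE in k0 *.
move: (hnorm xu) (hnorm xj) Nab Zu Zj Su Sj BR xu_ge0 xj_ge0.
move=> s t st Zu Zj Su Sj BR s_ge0 t_ge0.
have [s0|s0] := eqVneq s 0.
  have [-> ->] := Zu s0; rewrite !add0r; have t1 : t = 1 by rewrite -st s0 add0r.
  move: k0 Sj; have [_ ->] := Zu s0; rewrite add0r t1 !divr1 => b1_ge0; exact.
have [t0|t0] := eqVneq t 0.
  have [-> ->] := Zj t0; rewrite !addr0; have s1 : s = 1 by rewrite -st t0 addr0.
  move: k0 Su; have [_ ->] := Zj t0; rewrite addr0 s1 !divr1 => a1_ge0; exact.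
have {s_ge0} s_gt0 : 0 < s by rewrite lt_def s0.
have {t_ge0} t_gt0 : 0 < t by rewrite lt_def t0.
(* If both parts lie in the closed upper half plane, their normalized values suffice; if one lies
   below, it is replaced by the real crossing point; both below contradicts [k0]. *)
have [a1_ge0|a1_lt0] := lerP 0 a1; have [b1_ge0|b1_lt0] := lerP 0 b1.
- have tE : 1 - s = t by rewrite -st addrC addKr.
  apply: (convex_combination (t := s) convexS (ltW s_gt0) _
           (Su s_gt0 a1_ge0) (Sj t_gt0 b1_ge0)).
  + by rewrite -st lerDl ltW.
  + by rewrite tE /= !mulrA ![_ * _ / _]mulrAC !divff ?mul1r.
  + by rewrite tE /= !mulrA ![_ * _ / _]mulrAC !divff ?mul1r.
- have a1_gt0 : 0 < a1 by move: b1_lt0 k0; lra.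
  apply: (convex_cone_combination (s := s) (t := t)) => //.
  + exact: ltW.
  + exact: Su.
  (* Forms scale by squares, so the weights [- b1] and [a1] enter through their square roots. *)
  + have := BR (Num.sqrt (- b1)) (Num.sqrt a1); rewrite !sqr_sqrtr ?oppr_ge0 ?ltW//.
    apply.
      by rewrite addr_gt0 ?mulr_gt0 ?oppr_gt0.
    by rewrite mulNr mulrC addNr.
- have b1_gt0 : 0 < b1 by move: a1_lt0 k0; lra.
  rewrite (addrC a0) (addrC a1).
  apply: (convex_cone_combination (s := t) (t := s)) => //.
  + exact: ltW.
  + by rewrite addrC.
  + by rewrite addrC.
  + exact: Sj.
  + have := BR (Num.sqrt b1) (Num.sqrt (- a1)); rewrite !sqr_sqrtr ?oppr_ge0 ?ltW//.
    rewrite (addrC (b1 * a0)) (addrC (b1 * s)); apply.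
      by rewrite addr_gt0 ?mulr_gt0 ?oppr_gt0.
    by rewrite mulNr mulrC addrN.
- by move: a1_lt0 b1_lt0 k0; lra.
Qed.

End HullInclusion.

(** * Compactness of the real part of the bild *)

Section Extrema.
Variables (R : realType).

Section QuaternionContinuity.
Variable T : topologicalType.
Implicit Types f g : T -> quat R.

(** Continuity is stated by coordinates, as [quat R] is given no topology. *)
Definition qcontinuous f := [/\ continuous (fun t => qre (f t) : R),
  continuous (fun t => qi (f t) : R), continuous (fun t => qj (f t) : R) &
  continuous (fun t => qk (f t) : R)].

Lemma qcontinuous_cst q : qcontinuous (fun=> q).
Proof. by split=> t; apply: cst_continuous. Qed.

Lemma qcontinuousD f g : qcontinuous f -> qcontinuous g ->
  qcontinuous (fun t => f t + g t).
Proof.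
by move=> [f0 f1 f2 f3] [g0 g1 g2 g3]; split=> t; apply: (@continuousD R R^o T);
  move: t.
Qed.

Lemma qcontinuous_conj f : qcontinuous f -> qcontinuous (fun t => quat_conj (f t)).
Proof.
by move=> [f0 f1 f2 f3]; split=> //= t; apply: (@continuousN R R^o T); move: t.
Qed.

Lemma qcontinuousM f g : qcontinuous f -> qcontinuous g ->
  qcontinuous (fun t => f t * g t).
Proof.
move=> [f0 f1 f2 f3] [g0 g1 g2 g3].
have cM (a b : T -> R) : continuous a -> continuous b -> continuous (fun t => a t * b t).
  by move=> ca cb t; apply: continuousM; [exact: ca|exact: cb].
have cD (a b : T -> R) : continuous a -> continuous b -> continuous (fun t => a t + b t).
  by move=> ca cb t; apply: (@continuousD R R^o T); [exact: ca|exact: cb].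
have cB (a b : T -> R) : continuous a -> continuous b -> continuous (fun t => a t - b t).
  by move=> ca cb t; apply: (@continuousB R R^o T); [exact: ca|exact: cb].
split.
- exact: cB (cB _ _ (cB _ _ (cM _ _ f0 g0) (cM _ _ f1 g1)) (cM _ _ f2 g2)) (cM _ _ f3 g3).
- exact: cB (cD _ _ (cD _ _ (cM _ _ f0 g1) (cM _ _ f1 g0)) (cM _ _ f2 g3)) (cM _ _ f3 g2).
- exact: cD (cD _ _ (cB _ _ (cM _ _ f0 g2) (cM _ _ f1 g3)) (cM _ _ f2 g0)) (cM _ _ f3 g1).
- exact: cD (cB _ _ (cD _ _ (cM _ _ f0 g3) (cM _ _ f1 g2)) (cM _ _ f2 g1)) (cM _ _ f3 g0).
Qed.

Lemma qcontinuous_sum (I : Type) (r : seq I) (F : I -> T -> quat R) :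
  (forall i, qcontinuous (F i)) -> qcontinuous (fun t => \sum_(i <- r) F i t).
Proof.
move=> cF; elim: r => [|i r IH].
  rewrite (_ : (fun _ => _) = fun=> 0); first exact: qcontinuous_cst.
  by apply/funext => t; rewrite big_nil.
rewrite (_ : (fun _ => _) = fun t => F i t + \sum_(j <- r) F j t).
  exact: qcontinuousD.
by apply/funext => t; rewrite big_cons.
Qed.

Lemma qcontinuous_qform n (A : 'M[quat R]_n) (x : T -> 'cV[quat R]_n) :
  (forall i, qcontinuous (fun t => x t i ord0)) -> qcontinuous (fun t => qform A (x t)).
Proof.
move=> cx; rewrite (_ : (fun _ => _) =
    fun t => \sum_i \sum_j quat_conj (x t i ord0) * A i j * x t j ord0); last first.
  by apply/funext => t; rewrite /qform qpairE.
apply: qcontinuous_sum => i; apply: qcontinuous_sum => j.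
apply: qcontinuousM => //; apply: qcontinuousM; last exact: qcontinuous_cst.
exact: qcontinuous_conj.
Qed.

End QuaternionContinuity.

Variables (n : nat) (A : 'M[quat R]_n).

(** Real coordinates for quaternionic vectors: closed bounded sets of rows are compact. *)
Definition cv_of_row (v : 'rV[R]_(n * 4)) : 'cV[quat R]_n :=
  \col_i Quat (v ord0 (mxvec_index i 0)) (v ord0 (mxvec_index i 1))
              (v ord0 (mxvec_index i 2)) (v ord0 (mxvec_index i 3)).

Lemma cv_of_row_surj (x : 'cV[quat R]_n) : exists v, cv_of_row v = x.
Proof.
exists (mxvec (\matrix_(i < n, k < 4)
  nth 0 [:: qre (x i ord0); qi (x i ord0); qj (x i ord0); qk (x i ord0)] k)).
apply/matrixP => i j; rewrite (ord1 j) !mxE !mxvecE !mxE.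
by case: (x i ord0).
Qed.

Lemma cv_of_row_continuous i : qcontinuous (fun v => cv_of_row v i ord0).
Proof.
have -> : (fun v => cv_of_row v i ord0) = fun v : 'rV[R]_(n * 4) =>
    Quat (v ord0 (mxvec_index i 0)) (v ord0 (mxvec_index i 1))
              (v ord0 (mxvec_index i 2)) (v ord0 (mxvec_index i 3)).
  by apply/funext => v; rewrite mxE.
by split=> /=; exact: coord_continuous.
Qed.

(** Makes the set of rows of unit vectors bounded in the maximum norm. *)
Lemma cv_of_row_norm (v : 'rV[R]_(n * 4)) k : v ord0 k ^+ 2 <= hnorm (cv_of_row v).
Proof.
case/mxvec_indexP: k => i k.
rewrite hnorm_sum (bigD1 i) //=.
apply: le_trans (_ : qnorm (cv_of_row v i ord0) <= _); last first.
  by rewrite lerDl sumr_ge0 // => j _; exact: qnorm_ge0.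
rewrite mxE /qnorm /=.
case: k => [[|[|[|[|k]]]] Hk] //.
- rewrite (_ : Ordinal Hk = 0); last exact/val_inj.
  by rewrite -!addrA lerDl !addr_ge0 ?sqr_ge0.
- rewrite (_ : Ordinal Hk = 1); last exact/val_inj.
  by rewrite [_ ^+ 2 + _]addrC -!addrA lerDl !addr_ge0 ?sqr_ge0.
- rewrite (_ : Ordinal Hk = 2); last exact/val_inj.
  by rewrite -addrA addrCA lerDl !addr_ge0 ?sqr_ge0.
- rewrite (_ : Ordinal Hk = 3); last exact/val_inj.
  by rewrite lerDr !addr_ge0 ?sqr_ge0.
Qed.

(** The set on which the real part of the form takes exactly the values in [real_bild A]. *)
Let real_rows : set 'rV[R]_(n * 4) := [set v | hnorm (cv_of_row v) = 1 /\
  exists r, qform A (cv_of_row v) = Quat r 0 0 0].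

Let qform_row_continuous (B : 'M[quat R]_n) :
  qcontinuous (fun v => qform B (cv_of_row v)).
Proof. by apply: qcontinuous_qform => i; exact: cv_of_row_continuous. Qed.

Lemma real_rows_compact : compact real_rows.
Proof.
apply: bounded_closed_compact.
  exists 1; split=> // M M1 v [v1 _].
  apply: le_trans (ltW M1); rewrite [leLHS]/Num.norm /= mx_normrE.
  apply: bigmax_le => // -[i k] _ /=; rewrite ord1.
  rewrite -(ler_pXn2r (n := 2)) ?nnegrE// expr1n real_normK ?num_real// -v1.
  exact: cv_of_row_norm.
have [N0 _ _ _] := qform_row_continuous 1%:M.
have [_ c1 c2 c3] := qform_row_continuous A.
have -> : real_rows =
  (fun v => qre (qform 1%:M (cv_of_row v))) @^-1` [set 1] `&`
  ((fun v => qi (qform A (cv_of_row v))) @^-1` [set 0] `&`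
  ((fun v => qj (qform A (cv_of_row v))) @^-1` [set 0] `&`
   (fun v => qk (qform A (cv_of_row v))) @^-1` [set 0])).
  apply/seteqP; split=> v.
    by move=> [N1 [r vr]]; split; [rewrite /= -hnormE|rewrite /= vr].
  move=> [N1 [h1 [h2 h3]]]; split; first by rewrite hnormE.
  exists (qre (qform A (cv_of_row v))).
  by move: h1 h2 h3 => /=; case: (qform A _) => a b c d /= -> -> ->.
by do !apply: closedI; apply: preimage_closed => //; exact: closed_eq.
Qed.

Lemma real_bildP r : real_bild A r <->
  exists2 x, hnorm x = 1 & qform A x = Quat r 0 0 0.
Proof.
split=> [/numrangeHP[x x1 xr]|[x x1 xr]]; first by exists x.
by apply/numrangeHP; exists x.
Qed.

Lemma real_bild_row r : real_bild A r -> exists2 v,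
  v \in real_rows & qform A (cv_of_row v) = Quat r 0 0 0.
Proof.
move=> /real_bildP[x x1 xr]; have [v vx] := cv_of_row_surj x.
by exists v; rewrite ?inE /real_rows /= vx//; split=> //; exists r.
Qed.

(** The extreme value theorem for the real part of the form on the compact set [real_rows]. *)
Lemma real_bild_extrema : real_bild A !=set0 ->
  min_set (real_bild A) !=set0 /\ max_set (real_bild A) !=set0.
Proof.
move=> [r0 /real_bild_row[v0]]; rewrite inE => v0R _.
have rows0 : real_rows !=set0 by exists v0.
have [c0 _ _ _] := qform_row_continuous A.
pose f v := qre (qform A (cv_of_row v)).
have fc : {within real_rows, continuous f} by apply: continuous_subspaceT; exact: c0.
have fB v : v \in real_rows -> real_bild A (f v).
  rewrite inE => -[v1 [r vr]]; apply/real_bildP.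
  by exists (cv_of_row v); rewrite // /f vr.
split.
  have [c cR cm] := EVT_min_rV rows0 real_rows_compact fc.
  exists (f c); split; first exact: fB.
  by move=> r /real_bild_row[v vR vr]; have := cm v vR; rewrite {2}/f vr.
have [c cR cm] := EVT_max_rV rows0 real_rows_compact fc.
exists (f c); split; first exact: fB.
by move=> r /real_bild_row[v vR vr]; have := cm v vR; rewrite {1}/f vr.
Qed.

End Extrema.

(** * Existence of real points *)

Section RealPoint.
Variable R : realType.

(** Inverts [rotate_to_i]: from conj p v p = N k i follows N^2 v = N k (p i conj p), so conj p
    carries i to a multiple of [v] and the factor [s] corrects the length. *)
Lemma rotate_from_i (v : quat R) : qre v = 0 ->
  exists p, quat_conj p * Quat 0 1 0 0 * p = v.
Proof.
move=> v0; pose k := Num.sqrt (qvec2 v).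
have hk : qvec2 v = k ^+ 2 by rewrite sqr_sqrtr ?qvec2_ge0.
have [p p0 hp] := rotate_to_i hk; set N := qnorm p in p0 hp.
pose s := Num.sqrt (k / N).
have s2 : s ^+ 2 = k / N by rewrite sqr_sqrtr// divr_ge0 ?sqrtr_ge0 ?ltW.
exists (quat_conj p * qreal s); set w := p * Quat 0 1 0 0 * quat_conj p.
have -> : quat_conj (quat_conj p * qreal s) * Quat 0 1 0 0 * (quat_conj p * qreal s) =
          qreal (s ^+ 2) * w.
  rewrite qconjM qconjK qconj_real /w; move: (s) (p) => s' [a b c d].
  by rewrite !quatE; congr Quat => /=; ring.
have pp : p * quat_conj p = qreal N.
  by rewrite /N; case: (p) => a b c d; rewrite !quatE /qnorm; congr Quat => /=; ring.
have eN : qreal N * v * qreal N = qreal (N * k) * w.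
  rewrite -{1}pp -pp; transitivity (p * (quat_conj p * v * p) * quat_conj p).
    by rewrite !mulrA.
  rewrite hp v0 mulr0 /w; move: (N * k) => M; case: (p) => a b c d.
  by rewrite !quatE; congr Quat => /=; ring.
have N0 : N != 0 by rewrite gt_eqF.
have NN : N ^+ 2 != 0 by rewrite expf_neq0.
have {}s2 : s ^+ 2 = (N ^+ 2)^-1 * (N * k) by rewrite s2; field.
have -> : qreal (s ^+ 2) * w = qreal (N ^+ 2)^-1 * (qreal (N * k) * w).
  by rewrite s2 [RHS]mulrA; congr (_ * _); rewrite !quatE; congr Quat => /=; ring.
rewrite -eN; move: (N) N0 NN (v) => M M0 MM [a b c d].
by rewrite !quatE; congr Quat => /=; field.
Qed.

Variables (n : nat) (A : 'M[quat R]_n).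

(* Completing the square in [p], with [2 k i m = x^*Ae - conj (e^*Ax)]. *)
Lemma real_value_on_plane (x e : 'cV[quat R]_n) (h k : R) :
  qform A x = Quat h k 0 0 -> k != 0 ->
  exists p, qvec2 (qform A (qscale x p + e)) = 0.
Proof.
move=> hx k0; pose a := qpair A x e; pose c := qpair A e x; pose E := qform A e.
pose l := a - quat_conj c.
pose m := Quat 0 (- (2 * k)^-1) 0 0 * l.
(* The value that conj p (k i) p must take for the vector parts to cancel; it is purely imaginary,
   hence reached by [rotate_from_i]. *)
pose r := qreal k * (quat_conj m * Quat 0 1 0 0 * m) - (E - qreal (qre E)).
have [|p hp] := @rotate_from_i (qreal k^-1 * r).
  by rewrite /r; move: (m) (E) => [m0 m1 m2 m3] [e0 e1 e2 e3]; rewrite !quatE /=; ring.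
exists (p - m).
rewrite qformD qformZ hx -[e]qscale1 !qpairZ qscale1 -/a -/c -/E.
have {}hp : qreal k * (quat_conj p * Quat 0 1 0 0 * p) = r.
  rewrite hp mulrA; case: (r) => r0 r1 r2 r3.
  by rewrite !quatE; congr Quat => /=; field.
have lm : qreal 2 * (qreal k * Quat 0 1 0 0 * m) = l.
  by rewrite /m; case: (l) => l0 l1 l2 l3; rewrite !quatE; congr Quat => /=; field.
have hV : forall F, F = quat_conj (p - m) * Quat h k 0 0 * (p - m) +
    (quat_conj (p - m) * a * 1 + quat_conj 1 * c * (p - m)) + E ->
    exists t, F = qreal t.
  move=> _ ->.
  have -> : a = qreal 2 * (qreal k * Quat 0 1 0 0 * m) + quat_conj c.
    by rewrite lm /l addrNK.
  have -> : E = r * qreal (-1) +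
      qreal k * (quat_conj m * Quat 0 1 0 0 * m) + qreal (qre E).
    rewrite /r; move: (m) (E) => [m0 m1 m2 m3] [e0 e1 e2 e3].
    by rewrite !quatE; congr Quat => /=; ring.
  rewrite -hp; move: (p) (m) (c) (qre E) => p' m' c' z.
  by eexists; rewrite !quatE; congr Quat => /=; ring.
have [t ->] := hV _ erefl.
by rewrite /qvec2 /= !expr0n /= !addr0.
Qed.

End RealPoint.

(** * The upper bild as a convex hull *)

Section MainTheorem.
Variables (R : realType) (n : nat) (A : 'M[R[i]]_n).

(** Two basis vectors [x] and [e] suffice: either x^*Ax is already real, or some [x p + e] has a
    real form value, and it is nonzero because its coordinate at [i1] is 1. *)
Lemma real_bild_neq0 : (1 < n)%N -> real_bild (quatmx A) !=set0.
Proof.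
move=> n1; pose i0 := Ordinal (ltnW n1); pose i1 := Ordinal n1.
pose x := quatcv (delta_mx i0 ord0 : 'cV[R[i]]_n).
pose e := quatcv (delta_mx i1 ord0 : 'cV[R[i]]_n).
have norm_gt0 (y : 'cV[quat R]_n) i : y i ord0 = 1 -> 0 < hnorm y.
  move=> yi; rewrite lt_def hnorm_ge0 andbT; apply/eqP => /hnorm_eq0 y0.
  by move: yi; rewrite y0 mxE => /esym/eqP; rewrite oner_eq0.
suff [y y0 yr] : exists2 y, 0 < hnorm y & qvec2 (qform (quatmx A) y) = 0.
  exists (qre (qform (quatmx A) y) / hnorm y).
  have [] : upper_bild (quatmx A) (qre (qform (quatmx A) y) / hnorm y)%:C; last by [].
  apply/upper_bildP; split=> //; exists y; split=> //.
    by rewrite divfK ?gt_eqF.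
  by rewrite yr mul0r expr0n.
have := qform_quatcv A (delta_mx i0 ord0); rewrite -/x.
case: (cform _ _) => h k hx; have [k0|k0] := eqVneq k 0.
  exists x; first by apply: (norm_gt0 _ i0); rewrite !mxE !eqxx.
  by rewrite hx k0 /qvec2 /= !expr0n /= !addr0.
have [p hp] := real_value_on_plane e hx k0.
exists (qscale x p + e) => //; apply: (norm_gt0 _ i1).
by rewrite mxE qscaleE !mxE !eqxx /= (_ : quat_of_complex 0 = 0) ?mul0r ?add0r.
Qed.

Lemma upper_numrangeC_sub_bild : upper_numrangeC A `<=` upper_bild (quatmx A).
Proof.
move=> z [/numrangeCP[u u1 ->] z0]; split=> //; apply/numrangeHP.
by exists (quatcv u); rewrite ?qform_quatcv.
Qed.

Lemma upper_numrangeC_adj_sub_bild :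
  upper_numrangeC (adjmx (@conjc R) A) `<=` upper_bild (quatmx A).
Proof.
move=> z [/numrangeCP[u u1 ->] z0]; split=> //; apply/numrangeHP.
by exists (qscale (quatcv u) (Quat 0 0 1 0)); rewrite ?hnorm_quatcv_j ?qform_quatcv_j.
Qed.

(** The given [r] makes the real bild nonempty, so its extreme points exist, and [r] lies on the
    segment joining them. *)
Lemma real_bild_convex_extrema (S : set R[i]) :
  let BR := real_bild (quatmx A) in
  @convex_set R (Rcomplex R) S -> [set v%:C | v in min_set BR] `<=` S ->
  [set v%:C | v in max_set BR] `<=` S -> forall r, BR r -> S r%:C.
Proof.
move=> BR cS minS maxS r Br.
have [|[m [Bm lem]] [M [BM geM]]] := @real_bild_extrema _ _ (quatmx A).
  by exists r.
have Sm : S m%:C by apply: minS; exists m.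
have SM : S M%:C by apply: maxS; exists M.
have mr : m <= r := lem _ Br; have rM : r <= M := geM _ Br.
have [mM|mM] := eqVneq m M.
  by have -> : r = m by apply: le_anti; rewrite mr mM rM.
have D0 : 0 < M - m by rewrite subr_gt0 lt_neqAle mM (le_trans mr).
apply: (convex_combination (t := (r - m) / (M - m)) cS _ _ SM Sm) => /=.
- by rewrite divr_ge0 ?subr_ge0 // (le_trans mr).
- by rewrite ler_pdivrMr // mul1r lerB.
- by field; rewrite gt_eqF.
- by rewrite !mulr0 addr0.
Qed.

End MainTheorem.

(** In dimension 1 the bild can miss the real axis, as for the matrix with single entry i. The
    extreme points therefore enter as sets, which are then empty. *)
Theorem theorem3p6 (R : realType) (n : nat) (A : 'M[R[i]]_n) :
  let BR : set R := real_bild (quatmx A) in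
  upper_bild (quatmx A) =
    conv_hull (upper_numrangeC A
               `|` upper_numrangeC (adjmx (@conjc R) A)
               `|` [set v%:C | v in min_set BR]
               `|` [set v%:C | v in max_set BR])
  /\ ((1 < n)%N -> min_set BR !=set0 /\ max_set BR !=set0).
Proof.
move=> BR; split; last by move=> /(real_bild_neq0 A)/real_bild_extrema.
apply/seteqP; split.
  (* The hull is the intersection of all convex sets containing the generators, so the inclusion is
     proved for each such [S]. *)
  move=> z zB S [cS]; rewrite !subUset => -[[[rangeS adjS] minS] maxS].
  exact: (upper_bild_sub_convex cS rangeS adjS (real_bild_convex_extrema cS minS maxS)).
apply: smallest_sub; first exact: upper_bild_convex.
have realB r : BR r -> upper_bild (quatmx A) r%:C by move=> Br; split=> //; exact: lexx.
rewrite !subUset; split; last by move=> _ [r [Br _] <-]; exact: realB.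
split; last by move=> _ [r [Br _] <-]; exact: realB.
split; first exact: upper_numrangeC_sub_bild.
exact: upper_numrangeC_adj_sub_bild.
Qed.
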